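(* Let $X$ and $Y$ be $c$-quasiconvex and complete metric spaces, let $G\subsetneq X$ be a domain, let $G'\subsetneq Y$ be a domain which is $c_1$-quasiconvex, and let $f:G\to G'$ be a weakly $H$-quasisymmetric homeomorphism. If $D\subset G$ is a subdomain which is $b$-uniform, then $D'=f(D)$ is $b'$-uniform, where the constant $b'$ depends only on $c$, $c_1$, $H$ and $b$.
   Context: All distances are written $|x-y|$. No local compactness is assumed. A domain is a nonempty open connected subset of the metric space. A metric space (or a domain, with the restricted metric) $Z$ is $c$-quasiconvex ($c\ge 1$) if each pair of points $x,y\in Z$ can be joined by an arc $\gamma$ in $Z$ with length $\ell(\gamma)\le c|x-y|$. A homeomorphism $f:G\to G'$ is weakly $H$-quasisymmetric if $|x-a|\le |x-b|$ implies $|f(x)-f(a)|\le H|f(x)-f(b)|$ for each triple $x,a,b$ of points in $G$. For a domain $D$ properly contained in a metric space $X$, $\delta_D(z)$ denotes the distance from $z\in D$ to the boundary $\partial D$ of $D$ in $X$; for domains in $Y$ the boundary is taken in $Y$. The domain $D$ is $b$-uniform if each pair of points $x,y\in D$ can be joined by a rectifiable arc $\gamma$ in $D$ such that (1) $\min\{\ell(\gamma[x,z]),\ell(\gamma[z,y])\}\le b\,\delta_D(z)$ for all $z\in\gamma$, and (2) $\ell(\gamma)\le b|x-y|$. Here $\ell$ denotes length and $\gamma[x,z]$ is the part of $\gamma$ between $x$ and $z$. *)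

(* Defs.v *)
From HB Require Import structures.
From mathcomp Require Import all_boot all_order all_algebra.
From mathcomp Require Import all_classical all_reals all_analysis.

Set Implicit Arguments.
Unset Strict Implicit.
Unset Printing Implicit Defensive.

Import Order.TTheory GRing.Theory Num.Theory.
Import numFieldNormedType.Exports.

Local Open Scope classical_set_scope.
Local Open Scope ring_scope.

(* [Complete] in the hierarchy is tied to pointed uniform spaces; this is
   completeness for an arbitrary metric space. *)
Definition complete_metric (R : realType) (X : metricType R) :=
  forall u : nat -> X, cauchy (u @ \oo) -> exists l : X, u @ \oo --> l.

Definition domain (T : topologicalType) (D : set T) :=
  [/\ D !=set0, open D & connected D].

Definition boundary (T : topologicalType) (A : set T) : set T :=
  closure A `\` interior A.

Section arcs.
Context {R : realType} {X : metricType R}.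
Implicit Types (s t : R) (g : R -> X).

(* Same shape as [variation], with [mdist] in place of the norm. *)
Definition polygonal_length s t g (p : seq R) : R :=
  let F := g \o nth t (s :: p) in
  \sum_(0 <= n < size p) mdist (F n) (F n.+1).

Definition path_length s t g : \bar R :=
  ereal_sup [set (polygonal_length s t g p)%:E | p in itv_partition s t].

(* An arc is presented by an injective continuous parametrization, defined on
   [s, t]. The case s = t is allowed: it is the one-point arc joining a point
   to itself, so that "each pair of points" may include pairs x = y. *)
Definition arc_in (Z : set X) (x y : X) s t g :=
  [/\ s <= t,
      {within `[s, t], continuous g},
      {in `[s, t] &, injective g},
      g @` `[s, t] `<=` Z
    & g s = x /\ g t = y].

Definition quasiconvex (c : R) (Z : set X) :=
  1 <= c /\
  forall x y, Z x -> Z y -> exists s t g,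
    arc_in Z x y s t g /\ (path_length s t g <= (c * mdist x y)%:E)%E.

(* [edist] is built from balls; on a metric space it is the given distance. *)
Lemma edist_mdist (x y : X) : edist (x, y) = (mdist x y)%:E.
Proof.
apply/eqP; rewrite eq_le; apply/andP; split.
  apply/lee_addgt0Pr => e e0; rewrite -EFinD; apply: edist_fin.
    by rewrite ltr_wpDl// mdist_ge0.
  by rewrite ballEmdist/= ltrDl.
apply: le_ereal_inf_tmp => _ [r [_ xyr] <-]; rewrite lee_fin.
by move: xyr; rewrite ballEmdist/= => /ltW.
Qed.

Definition boundary_dist (D : set X) (z : X) : \bar R :=
  edist_inf (boundary D) z.

(* The point z of the arc is g r, and its two subarcs are the restrictions of g
   to [s, r] and [r, t]. *)
Definition uniform_domain (b : R) (D : set X) :=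
  [/\ domain D, D `<` [set: X] &
    forall x y, D x -> D y -> exists s t g,
      [/\ arc_in D x y s t g,
          (path_length s t g < +oo)%E,
          (forall r, r \in `[s, t] ->
             (Order.min (path_length s r g) (path_length r t g)
                <= b%:E * boundary_dist D (g r))%E)
        & (path_length s t g <= (b * mdist x y)%:E)%E]].

End arcs.

(* Maps between the sets G and G' are represented by total functions, whose
   values outside G (resp. G') are irrelevant. *)
Definition homeomorphism_on (T U : topologicalType) (G : set T) (G' : set U)
    (f : T -> U) :=
  [/\ {within G, continuous f}, set_fun G G' f &
    exists g : U -> T,
      [/\ {within G', continuous g}, set_fun G' G g,
          {in G, cancel f g} & {in G', cancel g f}]].

Definition weakly_quasisymmetric (R : realType) (X Y : metricType R) (H : R)
    (G : set X) (f : X -> Y) :=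
  forall x a b, G x -> G a -> G b ->
    mdist x a <= mdist x b -> mdist (f x) (f a) <= H * mdist (f x) (f b).

(* Main.v *)
(* Quasiconvexity of D, resp. of G', upgrades weak quasisymmetry to a full
   three-point distortion estimate for f on D, resp. a small-scale one on G.
   Completeness of X extends these estimates to boundary points of D' = f(D).
   Along a cigar arc of D choose points z_i with |z_i - z_(i+1)| a fixed small
   multiple of the distance from z_i to the boundary. The length of the arc up
   to z_i then grows geometrically on the first half and decays geometrically
   on the second, so the distortion estimates make the distances
   d_i = |f z_i - f z_(i+1)| sum like a geometric series towards each end, while
   each d_i is small compared with the distance from f z_i to the boundary of
   D'. Joining consecutive f z_i by quasiconvexity arcs of Y and erasing loops
   gives the required arc. *)

Require Import Defs.
From mathcomp Require Import all_boot all_order all_algebra.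
From mathcomp Require Import all_classical all_reals all_analysis.
From mathcomp Require Import zify ring lra.

Set Implicit Arguments.
Unset Strict Implicit.
Unset Printing Implicit Defensive.

Import Order.TTheory GRing.Theory Num.Theory.
Import numFieldNormedType.Exports.

Local Open Scope classical_set_scope.
Local Open Scope ring_scope.

(** * Length of paths *)

Section path_length.
Context {R : realType} {X : metricType R}.
Implicit Types (s t m h : R) (g : R -> X) (p : seq R).

(** Recursive form of [polygonal_length], with the start point kept apart from the list as in
    [itv_partition], so that partitions can be treated by induction. *)
Fixpoint chain_length g s p : R :=
  if p is a :: p' then mdist (g s) (g a) + chain_length g a p' else 0.

Lemma polygonal_lengthE s t g p : polygonal_length s t g p = chain_length g s p.
Proof.
rewrite /polygonal_length; elim: p s => [|a p IH] s /=; first by rewrite big_nil.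
rewrite big_nat_recl//=; congr (_ + _); rewrite -IH.
by apply: eq_big_nat => i /andP[_ ip] /=; case: i ip.
Qed.

Lemma path_length_ub s t g p : path <%R s p -> last s p = t ->
  ((chain_length g s p)%:E <= path_length s t g)%E.
Proof.
move=> sp lp; apply: ereal_sup_ubound; exists p; last by rewrite polygonal_lengthE.
by rewrite /itv_partition; split => //; rewrite lp.
Qed.

Lemma path_length_lub s t g (M : \bar R) :
  (forall p, path <%R s p -> last s p = t -> ((chain_length g s p)%:E <= M)%E) ->
  (path_length s t g <= M)%E.
Proof.
move=> pM; apply: ge_ereal_sup => _ [p [sp /eqP lp] <-].
by rewrite polygonal_lengthE; exact: pM.
Qed.

Lemma path_last_le s p : path <%R s p -> s <= last s p.
Proof.
elim: p s => //= a p IH s /andP[sa ap]; exact: le_trans (ltW sa) (IH _ ap).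
Qed.

Lemma mdist_le_path_length s t g : s <= t ->
  ((mdist (g s) (g t))%:E <= path_length s t g)%E.
Proof.
rewrite le_eqVlt => /predU1P[->|st].
  by rewrite mdistxx; have /= := @path_length_ub t t g [::] isT erefl.
by have /= := @path_length_ub s t g [:: t]; rewrite st addr0; apply.
Qed.

Lemma path_length_ge0 s t g : s <= t -> (0 <= path_length s t g)%E.
Proof.
by move=> st; apply: le_trans (mdist_le_path_length g st); rewrite lee_fin mdist_ge0.
Qed.

Lemma path_length_consl s m t g : s <= m -> m <= t ->
  ((mdist (g s) (g m))%:E + path_length m t g <= path_length s t g)%E.
Proof.
rewrite le_eqVlt => /predU1P[->|sm] mt; first by rewrite mdistxx add0e.
rewrite addeC -leeBrDr//; apply: path_length_lub => p mp lp.
rewrite leeBrDr// -EFinD addrC.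
by have /= := @path_length_ub s t g (m :: p); rewrite sm mp; apply.
Qed.

Lemma chain_length_rcons g s p m :
  chain_length g s (rcons p m) = chain_length g s p + mdist (g (last s p)) (g m).
Proof. by elim: p s => [|a p IH] s /=; rewrite ?addr0 ?add0r// IH addrA. Qed.

Lemma path_length_consr s m t g : s <= m -> m <= t ->
  (path_length s m g + (mdist (g m) (g t))%:E <= path_length s t g)%E.
Proof.
move=> sm; rewrite le_eqVlt => /predU1P[->|mt]; first by rewrite mdistxx adde0.
rewrite -leeBrDr//; apply: path_length_lub => p mp lp.
rewrite leeBrDr// -EFinD -[in X in mdist (g X)]lp -chain_length_rcons.
by apply: path_length_ub; rewrite ?rcons_path ?mp ?lp//= last_rcons.
Qed.

Lemma path_length_subl s m t g : s <= m -> m <= t ->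
  (path_length m t g <= path_length s t g)%E.
Proof.
move=> sm mt; apply: le_trans (path_length_consl g sm mt).
by rewrite leeDr// lee_fin mdist_ge0.
Qed.

Lemma path_length_subr s m t g : s <= m -> m <= t ->
  (path_length s m g <= path_length s t g)%E.
Proof.
move=> sm mt; apply: le_trans (path_length_consr g sm mt).
by rewrite leeDl// lee_fin mdist_ge0.
Qed.

(** Walk down a partition of the whole interval until a step jumps over [m]; inserting [m] there
    does not shorten the polygon, by the triangle inequality. *)
Lemma path_length_cat s m t g : s <= m -> m <= t ->
  (path_length s t g <= path_length s m g + path_length m t g)%E.
Proof.
move=> sm mt; apply: path_length_lub => p; elim: p s sm => [|a p IH] s sm /=.
  move=> _ st; apply: adde_ge0; exact: path_length_ge0.
move=> /andP[sa ap] lp; have [am|ma] := leP a m.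
  rewrite EFinD; apply: le_trans (leeD2r _ (path_length_consl g (ltW sa) am)).
  by rewrite -addeA leeD2l// IH.
have mp : path <%R m (a :: p) by rewrite /= ma.
have := leeD (mdist_le_path_length g sm) (path_length_ub g mp lp).
apply: le_trans; rewrite -EFinD lee_fin /= addrA lerD2r.
exact: metric_triangle.
Qed.

Lemma path_length_eq s t g g' : {in `[s, t], g =1 g'} ->
  (path_length s t g <= path_length s t g')%E.
Proof.
move=> gg'; apply: path_length_lub => p sp lp.
suff -> : chain_length g s p = chain_length g' s p by exact: path_length_ub.
elim: p s sp lp gg' => //= a p IH s /andP[sa ap] lp gg'.
have at_ : a <= t by rewrite -lp path_last_le.
rewrite !gg' ?in_itv/= ?lexx ?(ltW sa) ?(le_trans (ltW sa))//.
congr (_ + _); apply: IH => // x; rewrite in_itv/= => /andP[ax xt].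
by apply: gg'; rewrite in_itv/= xt (le_trans (ltW sa)).
Qed.

Lemma path_length_shift s t h g :
  (path_length s t (fun x => g (x + h)%R) <= path_length (s + h)%R (t + h)%R g)%E.
Proof.
apply: path_length_lub => p sp lp.
have -> : chain_length (fun x => g (x + h)) s p =
    chain_length g (s + h) (map (fun x => x + h) p).
  by elim: p s {sp lp} => //= a p IH s; rewrite IH.
apply: path_length_ub; last by rewrite -lp; elim: p s {sp lp} => //=.
elim: p s sp {lp} => //= a p IH s /andP[sa ap].
by rewrite ltrD2r sa IH.
Qed.

End path_length.

(** * Concatenation of arcs with loop erasure *)

Section arcs.
Context {R : realType} {X : metricType R}.
Implicit Types (s t m : R) (g h k : R -> X) (Z : set X).

(** Retraction of the line onto [[s, t]]; composing with it turns a map continuous within the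
    segment into a globally continuous one. *)
Definition clamp s t (r : R) := Num.max s (Num.min r t).

Lemma clamp_itv s t r : s <= t -> clamp s t r \in `[s, t].
Proof.
by move=> st; rewrite in_itv/= /clamp le_max lexx/= ge_max st ge_min lexx orbT.
Qed.

Lemma clamp_id s t r : r \in `[s, t] -> clamp s t r = r.
Proof. by rewrite in_itv/= => /andP[sr rt]; rewrite /clamp min_l// max_r. Qed.

Lemma clamp_continuous s t : continuous (clamp s t).
Proof.
move=> x; apply: (@continuous_max R R (cst s) (fun r => Num.min r t)).
  exact: cvg_cst.
by apply: (@continuous_min R R id (cst t)); [exact: cvg_id|exact: cvg_cst].
Qed.

Lemma continuous_clamp s t g : s <= t -> {within `[s, t], continuous g} ->
  continuous (g \o clamp s t).
Proof.
move=> st /subspace_continuousP gc r.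
apply: cvg_trans (gc _ (clamp_itv r st)).
move=> A /= gA; have := @clamp_continuous s t r _ gA; rewrite /= nbhs_simpl/=.
by apply: filterS => q; apply; exact: clamp_itv.
Qed.

Lemma arc_in_continuous Z x y s t g : arc_in Z x y s t g ->
  exists g', [/\ arc_in Z x y s t g', continuous g' & {in `[s, t], g' =1 g}].
Proof.
move=> [st gc ginj gZ [gs gt]].
have E : {in `[s, t], g \o clamp s t =1 g} by move=> r /clamp_id/= ->.
have gc' := continuous_clamp st gc.
exists (g \o clamp s t); split=> //; split=> //.
- exact: continuous_subspaceT.
- by move=> r q rI qI; rewrite !E//; exact: ginj.
- by move=> _ [r rI <-]; apply: gZ; exists r => //; rewrite -E.
- by rewrite !E// in_itv/= lexx st.
Qed.

(* Follow [g] until it first hits the image of [h], then follow [h]. *)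
Lemma arc_cat Z x y z s t g s' t' h :
  arc_in Z x y s t g -> arc_in Z y z s' t' h ->
  exists m m' e k,
    [/\ m \in `[s, t], m' \in `[s', t'], m <= e & arc_in Z x z s e k] /\
    [/\ {in `[s, m], k =1 g},
        forall r, m <= r -> k r = h (r + (m' - m)) & e + (m' - m) = t'].
Proof.
move=> /[dup] garc /arc_in_continuous[g1 [[st _ ginj gZ [gs gt]] gc gE]] harc.
have [s't' hc hinj hZ [hs ht]] := harc.
pose C := h @` `[s', t'].
have Ccl : closed C.
  apply: compact_closed; first exact: metric_hausdorff.
  by apply: continuous_compact => //; exact: segment_compact.
(* The parameters at which [g1] meets the image of [h]: a compact set containing [t], so it has a
   least element [m]. *)
pose A := `[s, t] `&` g1 @^-1` C.
have [m] : exists2 m, m \in A & forall r, r \in A -> m <= r.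
  apply: (@compact_EVT_min R R id A).
  - exists t; split; first by rewrite /= in_itv/= lexx st.
    by exists s'; [rewrite /= in_itv/= lexx|rewrite hs].
  - apply: (@subclosed_compact _ _ `[s, t]); last by move=> r [].
      apply: closedI; first exact: itv_closed.
      by apply: closed_comp => // r _; exact: gc.
    exact: segment_compact.
  - by apply: continuous_subspaceT => r; exact: cvg_id.
rewrite inE => -[/= mI [m' m'I hm']] mmin.
have [sm mt] : s <= m /\ m <= t by move: mI; rewrite /= in_itv => /andP.
have [sm' mt'] : s' <= m' /\ m' <= t' by move: m'I; rewrite /= in_itv => /andP.
have gm : h m' = g m by rewrite hm' gE.
have first r : r \in `[s, m] -> C (g r) -> r = m.
  rewrite in_itv/= => /andP[sr rm] Cr; apply/eqP; rewrite eq_le rm/= mmin//.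
  have rI : r \in `[s, t] by rewrite in_itv/= sr (le_trans rm).
  by rewrite inE; split => //=; rewrite gE.
(* The shift by [m' - m] enters [h] at parameter [m'] when [r = m], where both branches agree by
   [gm]. *)
pose k r := if r <= m then g r else h (r + (m' - m)).
have km r : m <= r -> k r = h (r + (m' - m)).
  rewrite /k le_eqVlt => /predU1P[<-|mr]; last by rewrite leNgt mr.
  by rewrite lexx -gm addrC subrK.
have kg r : r <= m -> k r = g r by rewrite /k => ->.
pose e := t' - (m' - m).
have me : m <= e by rewrite /e; lra.
have hI r : m <= r <= e -> r + (m' - m) \in `[s', t'].
  by rewrite in_itv/= /e => /andP[mr re]; apply/andP; split; lra.
exists m, m', e, k; split; last first.
  by split=> //; [move=> r; rewrite in_itv/= => /andP[_]; exact: kg|exact: subrK].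
split=> //; have [_ gc0 ginj0 gZ0 [gs0 gt0]] := garc.
have gI r : s <= r <= m -> r \in `[s, t].
  by rewrite in_itv/= => /andP[-> rm]; rewrite (le_trans rm).
split.
- exact: le_trans me.
- have -> : `[s, e]%classic = `[s, m] `|` `[m, e].
    apply/seteqP; split=> r /=; rewrite !in_itv/=.
      by move=> /andP[-> ->]; rewrite andbT; case: (leP r m) => [|/ltW]; [left|right].
    by case=> /andP[ar rb]; rewrite ?ar ?rb ?(le_trans sm)// (le_trans rb).
  apply: withinU_continuous; [exact: itv_closed|exact: itv_closed| |].
    apply: (@subspace_eq_continuous _ _ _ g).
      move=> r; rewrite inE/= in_itv/= => /andP[_ rm]; exact/esym/kg.
    apply: continuous_subspaceW gc0 => r /=; rewrite !in_itv/= => /andP[->] rm.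
    exact: le_trans mt.
  apply: (@subspace_eq_continuous _ _ _ ((h \o clamp s' t') \o (fun r => r + (m' - m)))).
    move=> r; rewrite inE/= in_itv/= => /[dup] /andP[mr _] /hI/clamp_id rE.
    by apply: etrans (esym (km _ mr)); rewrite /= rE.
  apply: continuous_subspaceT => r; apply: continuous_comp; last first.
    exact: continuous_clamp.
  by apply: cvgD; [exact: cvg_id|exact: cvg_cst].
- move=> r q; wlog rq : r q / r <= q.
    by move=> W rI qI E; case/orP: (le_total r q) => ?; [exact: W|apply/esym; exact: W].
  rewrite !in_itv/= => /andP[sr re] /andP[sq qe].
  case: (leP q m) => qm.
    rewrite !kg ?(le_trans rq)// => E; apply: ginj0 => //; apply: gI.
      by rewrite sr (le_trans rq).
    by rewrite sq qm.
  rewrite (km q (ltW qm)); case: (leP r m) => rm; last first.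
    rewrite (km r (ltW rm)) => /(hinj _ _ (hI _ _) (hI _ _)).
    by rewrite !(ltW qm) (ltW rm) qe re => /(_ isT isT) /addIr.
  (* Mixed case: up to [m], the only point of [g] on [h] is [g m], and then injectivity of [h]
     forces [q = m], against [m < q]. *)
  rewrite (kg r rm) => E.
  have qI : q + (m' - m) \in `[s', t'] by apply: hI; rewrite qe (ltW qm).
  have rmE : r = m.
    by apply: first; [rewrite in_itv/= sr rm|rewrite E; exists (q + (m' - m))].
  rewrite rmE -gm in E; have /= := hinj _ _ m'I qI E.
  by rewrite rmE; lra.
- move=> q [r /=]; rewrite in_itv/= => /andP[sr re] <-; case: (leP r m) => rm.
    by rewrite kg//; apply: gZ0; exists r => //=; apply: gI; rewrite sr rm.
  rewrite (km _ (ltW rm)); apply: hZ; exists (r + (m' - m)) => //=.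
  by apply: hI; rewrite re (ltW rm).
- by rewrite kg// km// subrK.
Qed.

(** Arcs are appended one at a time by [arc_cat]. Loop erasure only discards pieces, so a surviving
    point of step [j] has at most the steps up to [j] before it and the steps from [j] on after
    it. *)
Lemma arc_chain Z (p : nat -> X) (l : nat -> R) n :
  (forall i, (i <= n)%N -> exists s t g,
     arc_in Z (p i) (p i.+1) s t g /\ (path_length s t g <= (l i)%:E)%E) ->
  exists s t g, arc_in Z (p 0%N) (p n.+1) s t g /\
    forall r, r \in `[s, t] -> exists2 j, (j <= n)%N &
      [/\ mdist (p j) (g r) <= l j,
          (path_length s r g <= (\sum_(0 <= i < j.+1) l i)%:E)%E &
          (path_length r t g <= (\sum_(j <= i < n.+1) l i)%:E)%E].
Proof.
elim: n => [|n IH] step.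
  have [s [t [g [garc gl]]]] := step 0%N isT.
  exists s, t, g; split=> // r; rewrite in_itv/= => /andP[sr rt]; exists 0%N => //.
  rewrite !big_nat1; have [_ _ _ _ [gs _]] := garc.
  have rl : (path_length s r g <= (l 0%N)%:E)%E.
    exact: le_trans (path_length_subr _ sr rt) gl.
  split=> //; last exact: le_trans (path_length_subl _ sr rt) gl.
  by rewrite -lee_fin -gs; apply: le_trans rl; exact: mdist_le_path_length.
have [s [t [g [garc gP]]]] := IH (fun i ni => step i (leqW ni)).
have [s' [t' [h [harc hl]]]] := step n.+1 (leqnn _).
have [m [m' [e [k [[mI m'I me karc] [kg kh eE]]]]]] := arc_cat garc harc.
have [sm mt] : s <= m /\ m <= t by move: mI; rewrite /= in_itv => /andP.
have [sm' mt'] : s' <= m' /\ m' <= t' by move: m'I; rewrite /= in_itv => /andP.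
have PLk a b : m <= a -> a <= b -> b <= e ->
    (path_length a b k <= (l n.+1)%:E)%E.
  move=> ma ab be.
  apply: (@le_trans _ _ (path_length a b (fun r => h (r + (m' - m))%R))).
    apply: path_length_eq => r; rewrite in_itv/= => /andP[ar _].
    by rewrite kh// (le_trans ma).
  apply: le_trans (path_length_shift _ _ _ _) _.
  apply: le_trans hl.
  apply: (@le_trans _ _ (path_length (a + (m' - m)) t' h)).
    by apply: path_length_subr; [rewrite lerD2r|rewrite -eE lerD2r].
  by apply: path_length_subl; [lra|rewrite -eE lerD2r (le_trans ab)].
have PLg a b : s <= a -> b <= m -> (path_length a b k <= path_length a b g)%E.
  move=> sa bm; apply: path_length_eq => r; rewrite in_itv/= => /andP[ar rb].
  by apply: kg; rewrite in_itv/= (le_trans sa)// (le_trans rb).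
exists s, e, k; split=> // r; rewrite in_itv/= => /andP[sr re].
case: (leP r m) => rm.
  have [|j jn [pj lj rj]] := gP r; first by rewrite in_itv/= sr (le_trans rm).
  exists j; first exact: leqW.
  split.
  - by rewrite kg// in_itv/= sr.
  - exact: le_trans (PLg _ _ (lexx _) rm) lj.
  - apply: le_trans (path_length_cat _ rm me) _.
    rewrite big_nat_recr ?(leqW jn)//= EFinD; apply: leeD; last exact: PLk.
    apply: le_trans rj; apply: le_trans (PLg _ _ sr (lexx _)) _.
    exact: path_length_subr.
(* Now [r] lies on the new arc. What precedes it is the old arc up to [m], bounded by the induction
   hypothesis at [m], and a piece of the new arc. *)
exists n.+1 => //; have [_ _ _ _ [hs _]] := harc; split.
- rewrite kh ?(ltW rm)// -hs -lee_fin; apply: le_trans hl.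
  apply: le_trans (mdist_le_path_length _ _) _; first by lra.
  by apply: path_length_subr; [lra|rewrite -eE lerD2r].
- apply: le_trans (path_length_cat _ sm (ltW rm)) _.
  rewrite big_nat_recr//= EFinD; apply: leeD; last by apply: PLk => //; exact: ltW.
  have [j jn [_ lj rj]] := gP m mI.
  have lge0 i : (i <= n)%N -> 0 <= l i.
    move=> ni; have [s1 [t1 [g1 [[st1 _ _ _ _] gl1]]]] := step i (leqW ni).
    by rewrite -lee_fin; apply: le_trans gl1; exact: path_length_ge0.
  apply: le_trans (PLg _ _ (lexx _) (lexx _)) _; apply: le_trans lj _.
  rewrite lee_fin [leRHS](big_cat_nat _ (n := j.+1))//= lerDl.
  by rewrite big_nat_cond; apply: sumr_ge0 => i /andP[/andP[_ ilt] _]; exact: lge0.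
- by rewrite big_nat1; apply: PLk => //; exact: ltW.
Qed.

End arcs.

(** * Three-point distortion of weakly quasisymmetric maps *)

Section greedy.
Context {R : realType} {X : metricType R}.
Implicit Types (s t : R) (g : R -> X).

Lemma mdist_continuous (a : X) : continuous (mdist a : X -> R).
Proof.
move=> x; apply/cvgrPdist_lt => e e0.
have : nbhs x (ball x e) by exact: nbhsx_ballx.
apply: filterS => y; rewrite ballEmdist/= => xy.
have := metric_triangle a x y; have := metric_triangle a y x.
by rewrite (metric_sym y x) => H1 H2; rewrite ltr_norml; apply/andP; split; lra.
Qed.

(** From the current point move along the arc to a parameter, given by the intermediate value
    theorem, where the distance is exactly [rho]. Each such step uses up at least [rho0] of the
    length, so there are at most [N] of them; the final step may be shorter. *)
Lemma greedy_chain g s t (rho : R -> R) rho0 (N : nat) :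
  0 < rho0 -> s <= t -> {within `[s, t], continuous g} ->
  {in `[s, t], forall r, rho0 <= rho r} ->
  (path_length s t g <= (N%:R * rho0)%:E)%E ->
  exists n (u : nat -> R),
    [/\ (n <= N)%N, u 0%N = s, u n.+1 = t & forall i, (i <= n)%N -> u i <= u i.+1] /\
    [/\ forall i, (i < n)%N -> mdist (g (u i)) (g (u i.+1)) = rho (u i) &
        mdist (g (u n)) (g (u n.+1)) <= rho (u n)].
Proof.
move=> rho0_gt0; elim: N s => [|N IH] s st gc rho_ge gl.
  exists 0%N, (fun i => if i is 0%N then s else t); split=> //; split=> //.
    by case.
  have sI : s \in `[s, t] by rewrite in_itv/= lexx.
  apply: le_trans (rho_ge _ sI); apply: (@le_trans _ _ 0); last exact: ltW.
  by rewrite -lee_fin; apply: le_trans (mdist_le_path_length g st) _; rewrite mul0r in gl.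
have sI : s \in `[s, t] by rewrite in_itv/= lexx.
have [near_|far] := leP (mdist (g s) (g t)) (rho s).
  exists 0%N, (fun i => if i is 0%N then s else t); split=> //; split=> //.
  by case.
have rhos : 0 < rho s by apply: lt_le_trans (rho_ge _ sI).
have [|| r] := @IVT R (fun r => mdist (g s) (g r)) s t (rho s) st.
- move=> r; apply: (@continuous_comp (subspace `[s, t]) X R g (mdist (g s))); first exact: gc.
  exact: mdist_continuous.
- rewrite /= mdistxx min_l ?mdist_ge0// max_r ?mdist_ge0//.
  by rewrite (ltW rhos) (ltW far).
rewrite in_itv/= => /andP[sr rt] srE.
have [||| n [u [[nN u0 un umon] [ufull ulast]]]] := IH r rt.
- apply: continuous_subspaceW gc => q /=; rewrite !in_itv/= => /andP[rq ->].
  by rewrite (le_trans sr).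
- move=> q; rewrite in_itv/= => /andP[rq qt]; apply: rho_ge.
  by rewrite in_itv/= qt (le_trans sr).
- have := le_trans (path_length_consl g sr rt) gl.
  rewrite srE addeC -leeBrDr// => /le_trans; apply.
  by rewrite -EFinB lee_fin -natr1 mulrDl mul1r; have := rho_ge _ sI; lra.
exists n.+1, (fun i => if i is j.+1 then u j else s); split.
  split=> // -[|i] ni; first by rewrite u0.
  exact: umon.
split=> // -[|i] ni; first by rewrite u0.
exact: ufull.
Qed.

Lemma nondecr_upto (u : nat -> R) n : (forall i, (i <= n)%N -> u i <= u i.+1) ->
  forall i j, (i <= j)%N -> (j <= n.+1)%N -> u i <= u j.
Proof.
move=> um i; elim=> [|j IH]; first by rewrite leqn0 => /eqP->.
rewrite leq_eqVlt => /predU1P[->//|ij] jn.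
by apply: le_trans (IH ij (ltnW jn)) (um _ _).
Qed.

End greedy.

Section distortion.
Context {R : realType}.
Implicit Types (H T E eps : R).

(** Quasisymmetry at a single ratio [T]. It occurs in two regimes: [T] arbitrary with some finite
    [E], and [E] prescribed with [T] small enough. *)
Definition distortion (X Y : metricType R) E T (D : set X) (f : X -> Y) :=
  forall z a w, D z -> D a -> D w ->
    mdist z a <= T * mdist z w -> mdist (f z) (f a) <= E * mdist (f z) (f w).

(** An arc from [z] to [a] of length at most [b * T * mdist z w] splits into boundedly many steps,
    all but the last of size exactly [mdist z w]. Weak quasisymmetry compares each image step with
    the preceding one, at the cost of a factor [H]. *)
Lemma distortion_large H b T : 1 <= H -> exists2 E, 0 < E &
  forall (X Y : metricType R) (G D : set X) (f : X -> Y),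
    weakly_quasisymmetric H G f -> D `<=` G -> quasiconvex b D ->
    distortion E T D f.
Proof.
move=> H1; set N := (Num.truncn (b * T)).+1.
have bTN : b * T <= N%:R by exact/ltW/Num.Theory.truncnS_gt.
exists (N.+1%:R * H ^+ N.+1).
  by rewrite mulr_gt0// exprn_gt0// (lt_le_trans _ H1).
move=> X Y G D f fH DG [b1 Db] z a w Dz Da Dw zaw.
have E0 : 0 <= N.+1%:R * H ^+ N.+1 by rewrite mulr_ge0// exprn_ge0// (le_trans _ H1).
(* [greedy_chain] needs a positive step size; if [z = w], then also [a = z]. *)
have [zw|zw] := eqVneq z w.
  move: zaw; rewrite -zw mdistxx mulr0 => za0.
  have -> : a = z.
    by apply/esym/mdist_positivity/le_anti; rewrite za0 mdist_ge0.
  by rewrite !mdistxx mulr0.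
have [s [t [g [[st gc ginj gD [gs gt]] gl]]]] := Db z a Dz Da.
have rho0 : 0 < mdist z w by rewrite mdist_gt0.
have glN : (path_length s t g <= (N%:R * mdist z w)%:E)%E.
  apply: le_trans gl _; rewrite lee_fin.
  apply: (@le_trans _ _ (b * (T * mdist z w))).
    by rewrite ler_wpM2l// (le_trans _ b1).
  by rewrite mulrA ler_wpM2r// ltW.
have [n [u [[nN u0 un umon] [ufull ulast]]]] :=
  @greedy_chain R X g s t (fun=> mdist z w) _ N rho0 st gc (fun _ _ => lexx _) glN.
have uI i : (i <= n.+1)%N -> D (g (u i)).
  move=> ni; apply: gD; exists (u i) => //=; rewrite in_itv/= -u0 -un.
  by rewrite !(nondecr_upto umon).
have ule i : (i <= n)%N -> mdist (g (u i)) (g (u i.+1)) <= mdist z w.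
  by rewrite leq_eqVlt => /predU1P[->//|ni]; rewrite ufull.
pose M := mdist (f z) (f w).
have M0 : 0 <= M by exact: mdist_ge0.
have H0 : 0 <= H by rewrite (le_trans _ H1).
have step i : (i <= n)%N ->
    mdist (f (g (u i))) (f (g (u i.+1))) <= H ^+ i.+1 * M.
  elim: i => [|i IH] ni.
    rewrite u0 gs expr1; apply: fH; [exact: DG| |exact: DG|].
      exact/DG/uI.
    by have := ule 0%N isT; rewrite u0 gs.
  rewrite exprS -mulrA; apply: le_trans (ler_wpM2l H0 (IH (ltnW ni))).
  rewrite (metric_sym (f (g (u i)))); apply: fH.
  - exact/DG/uI/leqW.
  - exact/DG/uI.
  - exact/DG/uI/leqW/ltnW.
  - by rewrite (metric_sym _ (g (u i))) (ufull i)// ule.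
have tot k : (k <= n.+1)%N ->
    mdist (f z) (f (g (u k))) <= k%:R * (H ^+ N.+1 * M).
  elim: k => [|k IH] kn; first by rewrite u0 gs mdistxx mul0r.
  apply: le_trans (metric_triangle _ (f (g (u k))) _) _.
  rewrite -natr1 mulrDl mul1r; apply: lerD; first exact/IH/ltnW.
  apply: le_trans (step k kn) _; rewrite ler_wpM2r// ler_weXn2l//.
  exact: leq_trans kn _.
have := tot _ (leqnn _); rewrite un gt => /le_trans; apply.
by rewrite mulrA ler_wpM2r// ler_wpM2r ?exprn_ge0// ler_nat ltnS.
Qed.

(* If [f a] were not close to [f z], a chain of few short steps from [f z] to
   [f w] in [G'] would pull back to a chain whose distance from [z] at most
   doubles (up to [mdist z a]) at each step, so that [w] could not be much
   further from [z] than [a]. *)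
Lemma distortion_small H c1 eps : 1 <= H -> 0 < eps -> exists2 tau, 0 < tau &
  forall (X Y : metricType R) (G : set X) (G' : set Y) (f : X -> Y),
    homeomorphism_on G G' f -> quasiconvex c1 G' ->
    weakly_quasisymmetric H G f -> distortion eps tau G f.
Proof.
move=> H1 eps0; have H0 : 0 < H by rewrite (lt_le_trans _ H1).
(* Bounds the number of steps of size [sg = r / (4 * H)] on an arc of length [c1 * S], where
   [S < r / eps] by the negated conclusion. *)
set N := (Num.truncn (c1 * (4 * H / eps))).+1.
have NP : c1 * (4 * H / eps) <= N%:R by exact/ltW/Num.Theory.truncnS_gt.
(* There are at most [N.+1] steps, each at most doubling; the extra factor 2 makes the final bound
   contradictory. *)
exists (2 ^+ N.+2)^-1; first by rewrite invr_gt0 exprn_gt0.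
move=> X Y G G' f [fc fG [f' [f'c f'G ff' f'f]]] [c11 G'c] fH z a w Gz Ga Gw zaw.
rewrite leNgt; apply/negP => big.
pose r := mdist (f z) (f a); pose S := mdist (f z) (f w).
have S0 : 0 <= S by exact: mdist_ge0.
have r0 : 0 < r by rewrite (le_lt_trans _ big)// mulr_ge0// ltW.
have [s [t [g [[st gc ginj gG' [gs gt]] gl]]]] := G'c _ _ (fG _ Gz) (fG _ Gw).
pose sg := r / (4 * H).
have sg0 : 0 < sg by rewrite divr_gt0// mulr_gt0.
have HsgE : H * sg = r / 4 by rewrite /sg; field; rewrite gt_eqF.
have glN : (path_length s t g <= (N%:R * sg)%:E)%E.
  apply: le_trans gl _; rewrite lee_fin -/S.
  apply: (@le_trans _ _ (c1 * (4 * H / eps) * sg)); last by rewrite ler_wpM2r// ltW.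
  have -> : c1 * (4 * H / eps) * sg = c1 * (r / eps).
    by rewrite /sg; field; rewrite !gt_eqF.
  by rewrite ler_wpM2l ?(le_trans _ c11)// ler_pdivlMr// mulrC ltW.
have [n [u [[nN u0 un umon] [ufull ulast]]]] :=
  @greedy_chain R Y g s t (fun=> sg) _ N sg0 st gc (fun _ _ => lexx _) glN.
have uI i : (i <= n.+1)%N -> G' (g (u i)).
  move=> ni; apply: gG'; exists (u i) => //=; rewrite in_itv/= -u0 -un.
  by rewrite !(nondecr_upto umon).
have ule i : (i <= n)%N -> mdist (g (u i)) (g (u i.+1)) <= sg.
  by rewrite leq_eqVlt => /predU1P[->//|ni]; rewrite ufull.
pose x i := f' (g (u i)).
have xG i : (i <= n.+1)%N -> G (x i) by move=> /uI/f'G.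
have fx i : (i <= n.+1)%N -> f (x i) = g (u i).
  by move=> /uI ni; rewrite /x f'f// inE.
have step i : (i <= n)%N -> mdist (x i) (x i.+1) <= mdist (x i) z + mdist z a.
  move=> ni; have [Gi Gi1] := (xG i (leqW ni), xG i.+1 ni).
  (* Otherwise [z] and [a] are both closer to [x i] than [x i.+1] is, so their images lie within
     [H * sg = r / 4] of [f (x i)], although they are [r] apart. *)
  rewrite leNgt; apply/negP => lt.
  have za0 := mdist_ge0 z a; have xz0 := mdist_ge0 (x i) z.
  have xz : mdist (f (x i)) (f z) <= r / 4.
    rewrite -HsgE; apply: le_trans (ler_wpM2l (ltW H0) (ule i ni)).
    rewrite -(fx i (leqW ni)) -(fx i.+1 ni); apply: fH => //; lra.
  have xa : mdist (f (x i)) (f a) <= r / 4.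
    rewrite -HsgE; apply: le_trans (ler_wpM2l (ltW H0) (ule i ni)).
    rewrite -(fx i (leqW ni)) -(fx i.+1 ni); apply: fH => //.
    by have := metric_triangle (x i) z a; lra.
  have := metric_triangle (f z) (f (x i)) (f a).
  rewrite (metric_sym (f z) (f (x i))) -/r; lra.
have tot k : (k <= n.+1)%N -> mdist z (x k) + mdist z a <= 2 ^+ k * mdist z a.
  elim: k => [|k IH] kn.
    by rewrite /x u0 gs ff' ?inE// mdistxx add0r expr0 mul1r.
  have := IH (ltnW kn); have := step k kn.
  have := metric_triangle z (x k) (x k.+1).
  by rewrite (metric_sym (x k) z) exprS -mulrA; lra.
have := tot _ (leqnn _); rewrite /x un gt ff' ?inE//.
have zw0 : 0 < mdist z w.
  rewrite mdist_gt0; apply/eqP => zw; move: zaw; rewrite -zw mdistxx mulr0 => za0.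
  have za : a = z.
    by apply/esym/mdist_positivity/le_anti; rewrite za0 mdist_ge0.
  by move: r0; rewrite /r za mdistxx ltxx.
have za0 := mdist_ge0 z a => le1.
have le2 : 2 ^+ n.+1 * mdist z a <= 2 ^+ N.+1 * mdist z a.
  by rewrite ler_wpM2r// ler_weXn2l// ler1n.
have le3 : 2 ^+ N.+1 * mdist z a <= mdist z w / 2.
  apply: le_trans (ler_wpM2l _ zaw) _; first by rewrite exprn_ge0.
  have : 0 < 2 ^+ N.+1 :> R by rewrite exprn_gt0.
  rewrite (exprS _ N.+1); move: (2 ^+ N.+1) => P P0.
  by rewrite invfM -mulrA mulrCA mulVKf ?gt_eqF// mulrC.
lra.
Qed.

End distortion.

(** * Distance to the boundary *)

Section boundary.
Context {R : realType} {X : metricType R}.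
Implicit Types (D C : set X) (z w : X).

(** Away from the boundary [D] coincides with its closure, so [C] meets [D] in a set both open and
    closed in [C]. *)
Lemma connected_avoid_boundary D C : open D -> connected C -> C `&` D !=set0 ->
  C `&` boundary D = set0 -> C `<=` D.
Proof.
move=> oD cC CD Cb.
have : C `&` D = C.
  apply: cC => //; first by exists D.
  exists (closure D); first exact: closed_closure.
  apply/seteqP; split=> x [Cx Dx]; split=> //; first exact: subset_closure.
  apply: contrapT => nDx; suff : set0 x by [].
  by rewrite -Cb; split=> //; split=> // /interior_subset.
by move=> <- x [].
Qed.

Lemma arc_avoid_boundary D Z x y s t g : open D -> D x -> arc_in Z x y s t g ->
  (forall r, r \in `[s, t] -> ~ boundary D (g r)) -> arc_in D x y s t g.
Proof.
move=> oD Dx [st gc ginj gZ [gs gt]] gb; split=> //.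
apply: connected_avoid_boundary => //.
- by apply: connected_continuous_connected => //; exact: segment_connected.
- by exists x; split=> //; exists s => //=; rewrite in_itv/= lexx.
- by apply/seteqP; split=> // _ [[r rI <-]]; exact: gb.
Qed.

(** An arc from a point of [D] to a point outside would stay in [D] if it met no boundary point.
    Nonemptiness makes the distance to the boundary finite. *)
Lemma boundary_nonempty c D : quasiconvex c [set: X] -> open D -> D !=set0 ->
  D `<` [set: X] -> boundary D !=set0.
Proof.
move=> [_ qX] oD [x Dx] DT; apply/set0P/eqP => b0.
have [y nDy] : exists y, ~ D y.
  by apply: contrapT => /forallNP DE; apply: DT.2 => y _; apply: contrapT; exact: DE.
have [s [t [g [garc _]]]] := qX x y I I.
have [|st _ _ gD [_ gt]] := arc_avoid_boundary oD Dx garc; first by move=> r _; rewrite b0.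
by apply: nDy; apply: gD; exists t => //=; rewrite in_itv/= st lexx.
Qed.

Lemma boundary_dist_le D z q : boundary D q ->
  (boundary_dist D z <= (mdist z q)%:E)%E.
Proof. by move=> bq; apply: ereal_inf_lbound; exists q => //; exact: edist_mdist. Qed.

Lemma le_boundary_dist D z (e : R) : (forall q, boundary D q -> e <= mdist z q) ->
  (e%:E <= boundary_dist D z)%E.
Proof.
by move=> eq_; apply: le_ereal_inf_tmp => _ [q bq <-]; rewrite edist_mdist lee_fin eq_.
Qed.

(** A real value for arithmetic. It represents [boundary_dist] when the boundary is nonempty; an
    infinite distance is sent to 0. *)
Definition bdist D z : R := fine (boundary_dist D z).

Lemma bdistE D z : boundary D !=set0 -> boundary_dist D z = (bdist D z)%:E.
Proof.
move=> [q bq]; rewrite fineK// ge0_fin_numE ?edist_inf_ge0//.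
exact: le_lt_trans (boundary_dist_le z bq) (ltry _).
Qed.

Lemma bdist_le D z q : boundary D q -> bdist D z <= mdist z q.
Proof. by move=> bq; rewrite -lee_fin -bdistE ?boundary_dist_le//; exists q. Qed.

Lemma bdist_gt0 D z : open D -> boundary D !=set0 -> D z -> 0 < bdist D z.
Proof.
move=> oD bD Dz; have : nbhs z D by exact: open_nbhs_nbhs.
rewrite -nbhs_ballE => -[e /= e0 zeD]; apply: lt_le_trans e0 _.
rewrite -lee_fin -bdistE//; apply: le_boundary_dist => q [_ nDq].
rewrite leNgt; apply/negP => zq; apply: nDq; apply: open_nbhs_nbhs; split=> //.
by apply: zeD; rewrite ballEmdist.
Qed.

Lemma bdist_lip D z w : boundary D !=set0 -> bdist D z <= mdist z w + bdist D w.
Proof.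
move=> bD; rewrite -lee_fin EFinD -!bdistE// -edist_mdist.
exact: edist_inf_triangle.
Qed.

Lemma bdist_continuous D : boundary D !=set0 -> continuous (bdist D : X -> R).
Proof.
move=> bD x; apply/cvgrPdist_lt => e e0.
have : nbhs x (ball x e) by exact: nbhsx_ballx.
apply: filterS => y; rewrite ballEmdist/= => xy.
have := bdist_lip x y bD; have := bdist_lip y x bD.
by rewrite (metric_sym y x) => H1 H2; rewrite ltr_norml; apply/andP; split; lra.
Qed.

Lemma uniform_quasiconvex b D : uniform_domain b D ->
  quasiconvex (Num.max b 1) D.
Proof.
move=> [_ _ uD]; split; first by rewrite le_max lexx orbT.
move=> x y Dx Dy; have [s [t [g [garc _ _ gl]]]] := uD x y Dx Dy.
exists s, t, g; split=> //; apply: le_trans gl _.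
by rewrite lee_fin ler_wpM2r ?mdist_ge0// le_max lexx.
Qed.

End boundary.

(** * Images of subdomains, and distortion up to their boundary *)

Section homeomorphism.
Context {R : realType} {X Y : metricType R}.

Lemma homeomorphism_on_continuous (G : set X) (G' : set Y) (f : X -> Y) x :
  open G -> homeomorphism_on G G' f -> G x -> {for x, continuous f}.
Proof.
by move=> oG [fc _ _] Gx; move: fc; rewrite continuous_open_subspace//; apply; rewrite inE.
Qed.

(** The image is open because it is the preimage of [D] under the inverse map, which is continuous
    on the open set [G']. *)
Lemma homeomorphism_on_domain (G D : set X) (G' : set Y) (f : X -> Y) :
  homeomorphism_on G G' f -> domain D -> D `<=` G -> domain G' ->
  domain (f @` D).
Proof.
move=> [fc fG [f' [f'c f'G ff' f'f]]] [[x Dx] oD cD] DG [_ oG' _]; split.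
- by exists (f x), x.
- have -> : f @` D = G' `&` f' @^-1` D.
    apply/seteqP; split=> [_ [z Dz <-]|y [G'y Dy]].
      by split; [exact/fG/DG|rewrite /= ff'// inE; exact: DG].
    by exists (f' y) => //; rewrite f'f// inE.
  by move: f'c; rewrite continuous_open_subspace// => /(continuous_inP _ oG'); apply.
- by apply: connected_continuous_connected => //; exact: continuous_subspaceW fc.
Qed.

(* If the estimate failed at [p], preimages of points of [f @` D] converging to
   [p] would stay within [d / 2] of [z] and be Cauchy, hence converge inside [D]. *)
Lemma boundary_distortion (G D : set X) (G' : set Y) (f : X -> Y) E T z a p d :
  complete_metric X -> open G -> homeomorphism_on G G' f -> open D -> D `<=` G ->
  open (f @` D) -> 0 < E -> 0 < T -> distortion E T D f ->
  (forall T', exists2 E', 0 < E' & distortion E' T' D f) ->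
  D z -> D a -> 0 < d -> (forall q, boundary D q -> d <= mdist z q) ->
  mdist z a <= T / 2 * d -> boundary (f @` D) p ->
  mdist (f z) (f a) <= E * mdist (f z) p.
Proof.
move=> cX oG fh oD DG oD' E0 T0 fET fE Dz Da d0 dq zad [clp nintp].
rewrite leNgt; apply/negP => big.
have nDp : ~ (f @` D) p by move=> Dp; apply: nintp; apply: open_nbhs_nbhs; split.
have zp0 : 0 < mdist (f z) p.
  by rewrite mdist_gt0; apply/eqP => zp; apply: nDp; exists z.
(* The slack: [E * (mdist (f z) p + kap)] equals [mdist (f z) (f a)]. *)
pose kap := (mdist (f z) (f a) - E * mdist (f z) p) / E.
have kap0 : 0 < kap by rewrite divr_gt0// subr_gt0.
have /choice[w wP] : forall n, exists w,
    [/\ D w, mdist p (f w) < kap & mdist p (f w) < n.+1%:R^-1].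
  move=> n; have e0 : 0 < Num.min kap n.+1%:R^-1 by rewrite lt_min kap0 invr_gt0/=.
  have [_ [[w Dw <-]]] := clp _ (nbhsx_ballx p _ e0).
  by rewrite ballEmdist/= lt_min => /andP[? ?]; exists w.
have Dw n : D (w n) by case: (wP n).
have wd n : mdist z (w n) < d / 2.
  (* Otherwise [fET] bounds [mdist (f z) (f a)] by [E * mdist (f z) (f (w n))], which is smaller by
     the choice of [kap]. *)
  have : ~~ (mdist z a <= T * mdist z (w n)).
    apply/negP => /(fET _ _ _ Dz Da (Dw n)).
    have [_ pw _] := wP n; have := metric_triangle (f z) p (f (w n)) => tr.
    apply/negP; rewrite -ltNge.
    have : E * mdist (f z) (f (w n)) < E * (mdist (f z) p + kap).
      by rewrite ltr_pM2l//; lra.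
    by rewrite mulrDr /kap [X in _ + X]mulrC divfK ?gt_eqF//; lra.
  rewrite -ltNge => lt; rewrite -(ltr_pM2l T0); lra.
have cw : cauchy (w @ \oo).
  apply: cauchy_exP => e e0.
  have [E' E'0 fE'] := fE (d / 2 / e).
  (* If [w N] and [w n] were at least [e] apart with images within [mu] of [p], distortion at ratio
     [d / 2 / e] would bound [mdist (f z) p] by [(1 + 2 * E') * mu], which is half of it. *)
  pose mu := mdist (f z) p / (2 * (1 + 2 * E')).
  have den : 0 < 2 * (1 + 2 * E') by lra.
  have mu0 : 0 < mu by rewrite divr_gt0.
  have muE : mu * (2 * (1 + 2 * E')) = mdist (f z) p by rewrite divfK// gt_eqF.
  pose N := Num.truncn mu^-1.
  have pN n : (N <= n)%N -> mdist p (f (w n)) < mu.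
    move=> Nn; have [_ _ /lt_le_trans] := wP n; apply.
    rewrite invf_ple ?posrE//; apply: ltW; apply: lt_le_trans (Num.Theory.truncnS_gt _) _.
    by rewrite ler_nat ltnS.
  exists (w N); exists N => // n /= Nn; rewrite ballEmdist/= ltNge; apply/negP => ewn.
  have : mdist (w N) z <= d / 2 / e * mdist (w N) (w n).
    rewrite metric_sym; apply: (@le_trans _ _ (d / 2 / e * e)).
      by rewrite divfK ?gt_eqF// ltW.
    by rewrite ler_wpM2l// ltW// !divr_gt0.
  move=> /(fE' _ _ _ (Dw N) Dz (Dw n)).
  have := pN n Nn; have := pN N (leqnn _).
  have := metric_triangle (f (w N)) p (f (w n)).
  have := metric_triangle (f z) (f (w N)) p.
  rewrite (metric_sym (f z) (f (w N))) (metric_sym (f (w N)) p) => t1 t2 pN1 pN2 t3.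
  have : E' * mdist (f (w N)) (f (w n)) <= E' * (mu + mu).
    by rewrite ler_pM2l//; lra.
  by have := mulr_gt0 mu0 E'0; nra.
have [l wl] := cX _ cw.
have zl : mdist z l <= d / 2.
  apply/ler_addgt0Pl => e e0.
  have : nbhs l (ball l e) by exact: nbhsx_ballx.
  move=> /wl [n _ /(_ n (leqnn _))]; rewrite /= ballEmdist/= => ln.
  have := metric_triangle z (w n) l; have := wd n.
  by rewrite (metric_sym (w n)); lra.
(* The limit [l] lies in the closure of [D], but at most [d / 2] away from [z], too close to be a
   boundary point. *)
have Dl : D l.
  apply: contrapT => nDl; have : boundary D l.
    split; last by move/interior_subset.
    move=> B /wl [n _ /(_ n (leqnn _)) /= Bn].
    by exists (w n).
  by move=> /dq; lra.
(* By continuity at [l] the points [f (w n)] tend to [f l] as well as to [p]. *)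
apply: nDp; exists l => //; apply/mdist_positivity/le_anti; rewrite mdist_ge0 andbT.
apply/ler_addgt0Pl => e e0; rewrite addr0.
have fl := homeomorphism_on_continuous oG fh (DG _ Dl).
have e20 : 0 < e / 2 by rewrite divr_gt0.
have : nbhs (f l) (ball (f l) (e / 2)) by exact: nbhsx_ballx.
move=> /fl; rewrite nbhs_simpl/= => /wl [n0 _ /= wn0].
pose n := maxn n0 (Num.truncn (e / 2)^-1).
have : mdist (f l) (f (w n)) < e / 2.
  by have := wn0 n (leq_maxl _ _); rewrite /= ballEmdist.
have : mdist p (f (w n)) < e / 2.
  have [_ _ /lt_le_trans] := wP n; apply.
  rewrite invf_ple ?posrE//; apply: ltW; apply: lt_le_trans (Num.Theory.truncnS_gt _) _.
  by rewrite ler_nat ltnS leq_maxr.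
have := metric_triangle (f l) (f (w n)) p.
by rewrite (metric_sym (f (w n)) p); lra.
Qed.

End homeomorphism.

(** * Geometric decay along a cigar *)

Section sums.
Context {R : realType}.
Implicit Types (d : nat -> R) (C : R).

(** All but the last [m.+1] terms are at most half the term [m.+1] places later, so together they
    make at most half of the sum. The sum is thus at most twice the last [m.+1] terms, each bounded
    by [C * d k]. *)
Lemma sum_le_last d C m k : 0 <= C -> (forall i, (i <= k)%N -> 0 <= d i) ->
  (forall i, (i <= k)%N -> d i <= C * d k) ->
  (forall i j, (i + m < j)%N -> (j <= k)%N -> d i <= d j / 2) ->
  \sum_(0 <= i < k.+1) d i <= 2 * m.+1%:R * C * d k.
Proof.
move=> C0 d0 dC dhalf.
have Cdk : 0 <= C * d k by rewrite mulr_ge0// d0.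
have tail a : (k.+1 - a <= m.+1)%N ->
    \sum_(a <= i < k.+1) d i <= m.+1%:R * (C * d k).
  move=> am; apply: (@le_trans _ _ (\sum_(a <= i < k.+1) C * d k)).
    by apply: ler_sum_nat => i /andP[_ ik]; exact: dC.
  by rewrite sumr_const_nat -(mulr_natl (C * d k)) ler_wpM2r// ler_nat.
have [km|mk] := leqP k.+1 m.+1.
  have := tail 0%N; rewrite subn0 => /(_ km) /le_trans; apply.
  by have := mulr_ge0 (ler0n R m.+1) Cdk; rewrite -!mulrA; lra.
set S := \sum_(0 <= i < k.+1) d i.
have SE : S = \sum_(0 <= i < k.+1 - m.+1) d i + \sum_(k.+1 - m.+1 <= i < k.+1) d i.
  by rewrite /S (big_cat_nat _ (n := k.+1 - m.+1)%N)//= leq_subr.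
have h1 : \sum_(0 <= i < k.+1 - m.+1) d i <= S / 2.
  apply: (@le_trans _ _ (\sum_(0 <= i < k.+1 - m.+1) d (i + m.+1)%N / 2)).
    apply: ler_sum_nat => i /andP[_ ik]; apply: dhalf; first by rewrite addnS.
    by rewrite -ltnS -ltn_subRL; move: ik; rewrite !subSS => ik; lia.
  have -> : \sum_(0 <= i < k.+1 - m.+1) d (i + m.+1)%N / 2 =
      (\sum_(m.+1 <= i < k.+1) d i) / 2.
    by rewrite -mulr_suml -[m.+1 in RHS]add0n big_addn.
  suff : \sum_(m.+1 <= i < k.+1) d i <= S by lra.
  have -> : S = \sum_(0 <= i < m.+1) d i + \sum_(m.+1 <= i < k.+1) d i.
    by apply: big_cat_nat => //; exact: ltnW.
  rewrite lerDr big_nat_cond; apply: sumr_ge0 => i /andP[/andP[_ im] _].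
  by apply: d0; lia.
have h2 : \sum_(k.+1 - m.+1 <= i < k.+1) d i <= m.+1%:R * (C * d k).
  by apply: tail; lia.
have : S <= S / 2 + m.+1%:R * (C * d k) by rewrite [leLHS]SE lerD.
by rewrite -!mulrA; lra.
Qed.

Lemma sum_le_first d C m k n : (k <= n)%N -> 0 <= C ->
  (forall i, (k <= i <= n)%N -> 0 <= d i) ->
  (forall i, (k <= i <= n)%N -> d i <= C * d k) ->
  (forall i j, (k <= j)%N -> (j + m < i <= n)%N -> d i <= d j / 2) ->
  \sum_(k <= i < n.+1) d i <= 2 * m.+1%:R * C * d k.
Proof.
move=> kn C0 d0 dC dhalf.
have -> : \sum_(k <= i < n.+1) d i = \sum_(0 <= i < (n - k).+1) d (n - i)%N.
  rewrite big_nat_rev/= -[k in LHS]add0n big_addn subSn//.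
  by apply: eq_big_nat => i /andP[_ ik]; congr d; lia.
have := @sum_le_last (fun i => d (n - i)%N) C m (n - k); rewrite subKn//; apply=> //.
- by move=> i ik; apply: d0; lia.
- by move=> i ik; apply: dC; lia.
- by move=> i j ij jk; apply: dhalf; lia.
Qed.

(** By Bernoulli's inequality. *)
Lemma exists_expr_ge (q M : R) : 0 < q -> exists m, M <= (1 + q) ^+ m.
Proof.
move=> q0; exists (Num.truncn (M / q)).+1; set m := _.+1.
have bern k : 1 + k%:R * q <= (1 + q) ^+ k.
  elim: k => [|k IH]; first by rewrite mul0r addr0.
  rewrite exprS -natr1; apply: le_trans (ler_wpM2l _ IH); last by lra.
  by have := mulr_ge0 (ler0n R k) (sqr_ge0 q); nra.
apply: le_trans (bern m); have : M / q < m%:R by exact: Num.Theory.truncnS_gt.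
by rewrite ltr_pdivrMr// => /ltW; lra.
Qed.

End sums.

(** * Sums of image distances along a chain *)

Section chain.
Context {R : realType} {X Y : metricType R}.
Context (D : set X) (f : X -> Y).

(* At least one of [z], [w] is at distance at least [mdist z w / 2] from [u],
   so it can serve as the third point in a comparison based at [u]. *)
Lemma step_compare E1 E2 tau T u v z w : 0 < E1 ->
  distortion E1 (2 * tau) D f -> distortion E2 T D f ->
  D u -> D v -> D z -> D w -> 0 <= tau ->
  mdist u v <= tau * mdist z w -> mdist z u <= T * mdist z w ->
  mdist (f u) (f v) <= E1 * (1 + E2) * mdist (f z) (f w).
Proof.
move=> E10 f1 f2 Du Dv Dz Dw tau0 uv zu.
have zu' := f2 _ _ _ Dz Du Dw zu.
have [uz|uz] := leP (mdist z w / 2) (mdist u z).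
  apply: (@le_trans _ _ (E1 * mdist (f u) (f z))).
    apply: f1 => //; apply: le_trans uv _; rewrite -mulrA mulrCA ler_wpM2l//; lra.
  rewrite -mulrA ler_pM2l// metric_sym mulrDl mul1r; apply: le_trans zu' _.
  by rewrite lerDr mdist_ge0.
apply: (@le_trans _ _ (E1 * mdist (f u) (f w))).
  apply: f1 => //; apply: le_trans uv _; rewrite -mulrA mulrCA ler_wpM2l//.
  by have := metric_triangle z u w; rewrite (metric_sym z u); lra.
rewrite -mulrA ler_pM2l// mulrDl mul1r.
by apply: le_trans (metric_triangle _ (f z) _) _; rewrite metric_sym addrC lerD2l.
Qed.

(* [lam i] and [mu i] are the lengths of the two subarcs cut off at [z i], and
   [del i] is the distance from [z i] to the boundary; the last step of the chain
   may be shorter than [t1 * del n]. *)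
Lemma chain_sums B t1 E1 E2 tau m n (z : nat -> X) (lam mu del : nat -> R) :
  0 < B -> 0 < t1 -> 0 < E1 -> 0 < E2 -> 0 < tau ->
  distortion E1 (2 * (B / t1)) D f -> distortion E2 (B / t1) D f ->
  distortion (2 * (1 + E2))^-1 tau D f ->
  2 * (B / t1) <= tau * (1 + t1 / B) ^+ m ->
  (forall i, (i <= n.+1)%N -> D (z i)) ->
  (forall i, (i < n)%N -> mdist (z i) (z i.+1) = t1 * del i) ->
  (forall i, (i <= n)%N -> lam i + mdist (z i) (z i.+1) <= lam i.+1) ->
  (forall i, (i <= n)%N -> mu i.+1 + mdist (z i) (z i.+1) <= mu i) ->
  (forall i, (i <= n.+1)%N -> 0 <= lam i /\ 0 <= mu i) ->
  (forall i, (i <= n)%N -> Num.min (lam i) (mu i) <= B * del i) ->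
  let d i := mdist (f (z i)) (f (z i.+1)) in
  let M := 2 * m.+1%:R * (1 + E1 * (1 + E2)) in
  forall k, (k <= n)%N ->
    \sum_(0 <= i < k.+1) d i <= M * d k \/ \sum_(k <= i < n.+1) d i <= M * d k.
Proof.
move=> B0 t10 E10 E20 tau0 f1 f2 fhalf mP Dz full lamS muS lm0 cigar d M k.
(* For [j < n] the smaller of [lam j] and [mu j] is at most [T] times the step at [z j], by [full]
   and [cigar]; [q = 1 / T] is its relative growth per step. *)
set T := B / t1 in f1 f2 mP; set q := t1 / B in mP.
have T0 : 0 < T by rewrite divr_gt0.
have q0 : 0 < q by rewrite divr_gt0.
have Tq : T * q = 1 by rewrite /T /q; field; rewrite !gt_eqF.
have d0 i : 0 <= d i by exact: mdist_ge0.
have E120 : 0 < E1 * (1 + E2) by rewrite mulr_gt0// addr_gt0.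
have C1 : 1 <= 1 + E1 * (1 + E2) by lra.
have qm0 : 0 < (1 + q) ^+ m by rewrite exprn_gt0//; lra.
have M1 : 1 <= M.
  rewrite /M; have : 1 <= m.+1%:R :> R by rewrite ler1n.
  by move: m.+1%:R => x x1; nra.
have large i j : (i <= n)%N -> (j <= n)%N ->
    mdist (z i) (z i.+1) <= T * mdist (z j) (z j.+1) ->
    mdist (z j) (z i) <= T * mdist (z j) (z j.+1) ->
    d i <= (1 + E1 * (1 + E2)) * d j.
  move=> ni nj h1 h2; apply: (@le_trans _ _ (E1 * (1 + E2) * d j)).
    by apply: (step_compare E10 f1 f2) => //; try exact: ltW; apply: Dz => //; exact: leqW.
  by rewrite ler_wpM2r// lerDr.
have small i j : (i <= n)%N -> (j <= n)%N ->
    (1 + q) ^+ m * mdist (z i) (z i.+1) <= T * mdist (z j) (z j.+1) ->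
    mdist (z j) (z i) <= T * mdist (z j) (z j.+1) ->
    d i <= d j / 2.
  move=> ni nj h1 h2.
  (* [mP] turns [h1] into a step ratio of at most [tau / 2]; [step_compare] then costs a factor
     [1 + E2], which the constant in [fhalf] absorbs. *)
  have -> : d j / 2 = (2 * (1 + E2))^-1 * (1 + E2) * d j.
    by field; rewrite gt_eqF //; lra.
  apply: (@step_compare _ _ (tau / 2) T) => //.
  - by rewrite invr_gt0; lra.
  - by rewrite mulrCA divff ?mulr1.
  - exact/Dz/leqW.
  - exact: Dz.
  - exact/Dz/leqW.
  - exact: Dz.
  - by rewrite divr_ge0// ltW.
  - rewrite -(ler_pM2l qm0); apply: le_trans h1 _.
    rewrite mulrA ler_wpM2r ?mdist_ge0//; lra.
have lam_le i j : (i <= j)%N -> (j <= n.+1)%N -> mdist (z i) (z j) + lam i <= lam j.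
  move=> ij; elim: j ij => [|j IH].
    by rewrite leqn0 => /eqP -> _; rewrite mdistxx add0r.
  rewrite leq_eqVlt => /predU1P[-> _|ij jn]; first by rewrite mdistxx add0r.
  have := IH ij (ltnW jn); have := lamS j jn; have := metric_triangle (z i) (z j) (z j.+1).
  lra.
have mu_le i j : (i <= j)%N -> (j <= n.+1)%N -> mdist (z i) (z j) + mu j <= mu i.
  move=> ij; elim: j ij => [|j IH].
    by rewrite leqn0 => /eqP -> _; rewrite mdistxx add0r.
  rewrite leq_eqVlt => /predU1P[-> _|ij jn]; first by rewrite mdistxx add0r.
  have := IH ij (ltnW jn); have := muS j jn; have := metric_triangle (z i) (z j) (z j.+1).
  lra.
have delE j : (j < n)%N -> B * del j = T * mdist (z j) (z j.+1).
  by move=> jn; rewrite full// /T; field; rewrite gt_eqF.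
(* The last step may be too short for the cigar bound, but for [k = n] the trailing sum is the
   single term [d n]. *)
rewrite leq_eqVlt => /predU1P[->|kn].
  by right; rewrite big_nat1; rewrite ler_peMl.
(* If [lam k <= mu k], the same holds at every earlier index, since [lam] does not decrease and [mu]
   does not increase. *)
have [lmk|/ltW mlk] := leP (lam k) (mu k); [left|right].
- have cig j : (j <= k)%N -> lam j <= T * mdist (z j) (z j.+1).
    move=> jk; rewrite -delE ?(leq_ltn_trans jk)//.
    have jn := leq_trans jk (ltnW kn).
    apply: le_trans (cigar j jn); rewrite le_min lexx/=.
    have := lam_le j k jk (ltnW (leqW kn)); have := mu_le j k jk (ltnW (leqW kn)).
    by have := mdist_ge0 (z j) (z k); lra.
  (* The step from [z j] is at least [q * lam j], so it multiplies [lam] by at least [1 + q]. *)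
  have growth i j : (i <= j)%N -> (j <= k)%N -> (1 + q) ^+ (j - i) * lam i <= lam j.
    move=> ij; elim: j ij => [|j IH].
      by rewrite leqn0 => /eqP -> _; rewrite expr0 mul1r.
    rewrite leq_eqVlt => /predU1P[-> _|ij jk]; first by rewrite subnn expr0 mul1r.
    rewrite subSn// exprS -mulrA.
    apply: (@le_trans _ _ ((1 + q) * lam j)).
      by rewrite ler_wpM2l ?IH//; [lra|exact: ltnW].
    apply: le_trans (lamS j (leq_trans (ltnW jk) (ltnW kn))).
    rewrite mulrDl mul1r lerD2l -(ler_pM2l T0) mulrA Tq mul1r.
    exact/cig/ltnW.
  have base i j : (i < j)%N -> (j <= k)%N -> mdist (z j) (z i) <= T * mdist (z j) (z j.+1).
    move=> ij jk; apply: le_trans (cig j jk).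
    have ij' := ltnW ij; have jn := leq_trans jk (ltnW (leqW kn)).
    have := lam_le i j ij' jn; rewrite (metric_sym (z i)).
    by have [] := lm0 i (leq_trans ij' jn); lra.
  have stepl i : (i <= n)%N -> mdist (z i) (z i.+1) <= lam i.+1.
    by move=> ni; have := lamS i ni; have [] := lm0 i (leqW ni); lra.
  apply: sum_le_last => //; first by lra.
    move=> i; rewrite leq_eqVlt => /predU1P[->|ik]; first by rewrite ler_peMl.
    have ni := leq_trans (ltnW ik) (ltnW kn).
    apply: large; [by []|exact: ltnW| |exact: base].
    apply: le_trans (cig k (leqnn k)); apply: le_trans (stepl _ ni) _.
    have kn' := ltnW (leqW kn).
    by have := lam_le i.+1 k ik kn'; have := mdist_ge0 (z i.+1) (z k); lra.
  move=> i j ij jk; have ij1 : (i < j)%N by apply: leq_ltn_trans ij; exact: leq_addr.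
  have jn := leq_trans jk (ltnW kn).
  apply: small; [exact: leq_trans (ltnW ij1) jn|by []| |exact: base].
  (* Step [i] is at most [lam i.+1], and at least [m] growth steps lie between [i.+1] and [j]. *)
  apply: le_trans (cig j jk).
  apply: le_trans (growth i.+1 j ij1 jk); apply: (@le_trans _ _ ((1 + q) ^+ m * lam i.+1)).
    by rewrite ler_pM2l//; exact: stepl (leq_trans (ltnW ij1) jn).
  have [l0 _] := lm0 i.+1 (leqW (leq_trans ij1 jn)).
  rewrite ler_wpM2r// ler_weXn2l//; first by lra.
  by rewrite leq_subRL// addSn addnC addSn addnC.
(* Mirror image on the second half, where [mu] shrinks by at least the factor [1 + q]. The index [j]
   stops before [n], whose step may be short; step [n] enters only as one to be bounded above. *)
- have cig j : (k <= j)%N -> (j < n)%N -> mu j <= T * mdist (z j) (z j.+1).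
    move=> kj jn; rewrite -delE//.
    apply: le_trans (cigar j (ltnW jn)); rewrite le_min lexx/= andbT.
    have jn' := ltnW (leqW jn).
    have := lam_le k j kj jn'; have := mu_le k j kj jn'.
    by have := mdist_ge0 (z k) (z j); lra.
  have growth i j : (k <= i)%N -> (i <= j)%N -> (j <= n)%N ->
      (1 + q) ^+ (j - i) * mu j <= mu i.
    move=> ki ij; elim: j ij => [|j IH].
      by rewrite leqn0 => /eqP -> _; rewrite expr0 mul1r.
    rewrite leq_eqVlt => /predU1P[-> _|ij jn]; first by rewrite subnn expr0 mul1r.
    rewrite subSn// exprSr -mulrA.
    have kj := leq_trans ki ij.
    apply: le_trans (IH ij (ltnW jn)); rewrite ler_wpM2l//.
      by rewrite exprn_ge0//; lra.
    have := muS j (ltnW jn); have := cig j kj jn.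
    have [_ muj] := lm0 j (ltnW (leqW jn)) => h1 h2.
    have h3 : q * mu j <= mdist (z j) (z j.+1).
      by rewrite -(ler_pM2l T0) mulrA Tq mul1r.
    have h4 : q * mu j.+1 <= q * mu j.
      by rewrite ler_pM2l//; have := mdist_ge0 (z j) (z j.+1); lra.
    lra.
  have base i j : (k <= j)%N -> (j < i)%N -> (i <= n)%N ->
      mdist (z j) (z i) <= T * mdist (z j) (z j.+1).
    move=> kj ji ni; have jn := leq_trans ji ni.
    apply: le_trans (cig j kj jn).
    have := mu_le j i (ltnW ji) (leqW ni); have [_] := lm0 i (leqW ni); lra.
  have stepl i : (i <= n)%N -> mdist (z i) (z i.+1) <= mu i.
    by move=> ni; have := muS i ni; have [_] := lm0 i.+1 ni; lra.
  apply: sum_le_first => //; first exact: ltnW; first by lra.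
    move=> i /andP[]; rewrite leq_eqVlt => /predU1P[<- _|ki ni].
      by rewrite ler_peMl.
    apply: large; [by []|exact: ltnW| |exact: base].
    apply: le_trans (cig k (leqnn k) kn); apply: le_trans (stepl _ ni) _.
    by have := mu_le k i (ltnW ki) (leqW ni); have := mdist_ge0 (z k) (z i); lra.
  move=> i j kj /andP[ji ni].
  have ji' : (j < i)%N by apply: leq_ltn_trans ji; exact: leq_addr.
  have jn := leq_trans ji' ni.
  apply: small; [by []|exact: ltnW| |exact: base].
  apply: le_trans (cig j kj jn).
  apply: le_trans (growth j i kj (ltnW ji') ni).
  apply: (@le_trans _ _ ((1 + q) ^+ m * mu i)).
    by rewrite ler_pM2l// stepl.
  have [_ mi0] := lm0 i (leqW ni).
  rewrite ler_wpM2r// ler_weXn2l//; first by lra.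
  by rewrite leq_subRL ?(ltnW ji')// ltnW.
Qed.

End chain.

(** * Uniformity of the image *)

(** The chain follows a cigar arc greedily with step size [t1 * bdist D]; [lam] and [mu] are the arc
    lengths before and after its points. The number [n] depends on the arc, but no later bound
    involves it. *)
Lemma uniform_chain (R : realType) (X : metricType R) (D : set X) (b B t1 : R) x y :
  boundary D !=set0 -> uniform_domain b D -> b <= B -> 0 < t1 ->
  D x -> D y -> exists n (z : nat -> X) (lam mu : nat -> R),
  [/\ z 0%N = x, z n.+1 = y, forall i, (i <= n.+1)%N -> D (z i) &
      forall i, (i <= n.+1)%N ->
        mdist x (z i) <= B * mdist x y /\ mdist (z i) y <= B * mdist x y] /\
  [/\ forall i, (i < n)%N -> mdist (z i) (z i.+1) = t1 * bdist D (z i),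
      forall i, (i <= n)%N -> mdist (z i) (z i.+1) <= t1 * bdist D (z i) &
      forall i, (i <= n)%N -> mdist (z i) (z i.+1) <= B * mdist x y] /\
  [/\ forall i, (i <= n)%N -> lam i + mdist (z i) (z i.+1) <= lam i.+1,
      forall i, (i <= n)%N -> mu i.+1 + mdist (z i) (z i.+1) <= mu i,
      forall i, (i <= n.+1)%N -> 0 <= lam i /\ 0 <= mu i &
      forall i, (i <= n)%N -> Num.min (lam i) (mu i) <= B * bdist D (z i)].
Proof.
move=> bD [[_ oD _] _ uD] bB t10 Dx Dy.
have [s [t [g [[st gc _ gD [gs gt]] gfin gcig gl]]]] := uD x y Dx Dy.
have gI r : s <= r -> r <= t -> D (g r).
  by move=> sr rt; apply: gD; exists r => //=; rewrite in_itv/= sr.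
(* By compactness the step size has a positive lower bound along the arc, so the greedy chain is
   finite. *)
have [c0 c0I c0min] : exists2 c0, c0 \in `[s, t] &
    forall r, r \in `[s, t] -> bdist D (g c0) <= bdist D (g r).
  apply: EVT_min => // r; apply: (@continuous_comp (subspace `[s, t]) X R g (bdist D)).
    exact: gc.
  exact: bdist_continuous.
have rho0 : 0 < t1 * bdist D (g c0).
  rewrite mulr_gt0// bdist_gt0//; move: c0I; rewrite in_itv/= => /andP[? ?]; exact: gI.
have fin a e : s <= a -> a <= e -> e <= t -> path_length a e g \is a fin_num.
  move=> sa ae et; rewrite ge0_fin_numE ?path_length_ge0//.
  apply: le_lt_trans gfin; apply: le_trans (path_length_subr _ ae et) _.
  exact: path_length_subl (le_trans ae et).
pose N := (Num.truncn (fine (path_length s t g) / (t1 * bdist D (g c0)))).+1.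
have [||n [u [[nN u0 un umon] [ufull ulast]]]] :=
    @greedy_chain R X g s t (fun r => t1 * bdist D (g r)) _ N rho0 st gc.
- by move=> r rI; rewrite ler_pM2l// c0min.
- rewrite -(fineK (fin s t (lexx _) st (lexx _))) lee_fin -ler_pdivrMr//.
  exact/ltW/Num.Theory.truncnS_gt.
have us i : (i <= n.+1)%N -> s <= u i by move=> ni; rewrite -u0 (nondecr_upto umon).
have ut i : (i <= n.+1)%N -> u i <= t by move=> ni; rewrite -un (nondecr_upto umon).
have LB : (path_length s t g <= (B * mdist x y)%:E)%E.
  by apply: le_trans gl _; rewrite lee_fin ler_wpM2r// mdist_ge0.
have sub a e : s <= a -> a <= e -> e <= t -> mdist (g a) (g e) <= B * mdist x y.
  move=> sa ae et; rewrite -lee_fin; apply: le_trans LB.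
  apply: le_trans (mdist_le_path_length _ ae) _.
  apply: le_trans (path_length_subr _ ae et) _.
  exact: path_length_subl (le_trans ae et).
exists n, (g \o u), (fun i => fine (path_length s (u i) g)),
  (fun i => fine (path_length (u i) t g)).
split; [split|split; split].
- by rewrite /= u0.
- by rewrite /= un.
- by move=> i ni; apply: gI; [exact: us|exact: ut].
- move=> i ni; have := sub (u i) t (us i ni) (ut i ni) (lexx _).
  by have := sub s (u i) (lexx _) (us i ni) (ut i ni); rewrite gs gt.
- by move=> i ni; rewrite ufull.
- by move=> i; rewrite leq_eqVlt => /predU1P[->//|ni]; rewrite /= ufull.
- by move=> i ni; apply: sub; rewrite ?us ?ut ?umon//; exact: leqW.
- move=> i ni; rewrite -lee_fin EFinD !fineK ?fin ?us ?ut ?(leqW ni)//.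
  by apply: path_length_consr; [exact/us/leqW|exact: umon].
- move=> i ni; rewrite -lee_fin EFinD !fineK ?fin ?us ?ut ?(leqW ni)// addeC.
  by apply: path_length_consl; [exact: umon|exact: ut].
- by move=> i ni; split; apply: fine_ge0; apply: path_length_ge0; rewrite ?us ?ut.
- move=> i ni; have ni' := leqW ni.
  have rI : u i \in `[s, t] by rewrite in_itv/= us ?ut.
  rewrite -lee_fin EFin_min !fineK ?fin ?us ?ut//; apply: le_trans (gcig _ rI) _.
  rewrite bdistE// -EFinM lee_fin ler_wpM2r// ltW// bdist_gt0//.
  by apply: gI; rewrite ?us ?ut.
Qed.

(** An arc joining [p i] to [p i.+1] with length at most [c * d i] stays within that distance of
    [p i]; the factor 4 in the hypothesis keeps it off the boundary, with each of its points at
    least [c * d i] away. *)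
Lemma uniform_arc_of_chain (R : realType) (Y : metricType R) (D : set Y)
    (c M K : R) (p : nat -> Y) n :
  quasiconvex c [set: Y] -> open D -> 0 <= M ->
  (forall i, (i <= n.+1)%N -> D (p i)) ->
  let d i := mdist (p i) (p i.+1) in
  (forall i q, (i <= n)%N -> boundary D q -> 4 * c * d i <= mdist (p i) q) ->
  (forall k, (k <= n)%N ->
     \sum_(0 <= i < k.+1) d i <= M * d k \/ \sum_(k <= i < n.+1) d i <= M * d k) ->
  \sum_(0 <= i < n.+1) d i <= K ->
  exists s t g,
    [/\ arc_in D (p 0%N) (p n.+1) s t g,
        (path_length s t g < +oo)%E,
        (forall r, r \in `[s, t] ->
           (Order.min (path_length s r g) (path_length r t g)
              <= M%:E * boundary_dist D (g r))%E)
      & (path_length s t g <= (c * K)%:E)%E].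
Proof.
move=> [c1 qY] oD M0 Dp d far sums tot.
have c0 : 0 < c by lra.
have d0 i : 0 <= d i by exact: mdist_ge0.
have arcs i : (i <= n)%N -> exists s t g,
    arc_in D (p i) (p i.+1) s t g /\ (path_length s t g <= (c * d i)%:E)%E.
  move=> ni; have [s [t [g [garc gl]]]] := qY (p i) (p i.+1) I I.
  exists s, t, g; split=> //; apply: (arc_avoid_boundary oD _ garc).
    exact/Dp/leqW.
  have [st _ _ _ [gs _]] := garc => r; rewrite in_itv/= => /andP[sr rt] br.
  have := far i _ ni br.
  have : mdist (p i) (g r) <= c * d i.
    rewrite -lee_fin -gs; apply: le_trans gl.
    exact: le_trans (mdist_le_path_length _ sr) (path_length_subr _ sr rt).
  (* A boundary point on the arc would be at most [c * d i] and at least [4 * c * d i] from [p i],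
     hence equal to the interior point [p i]. *)
  move=> h1 h2; have pg : p i = g r.
    apply/mdist_positivity/le_anti; rewrite mdist_ge0 andbT.
    have := mulr_ge0 (ltW c0) (d0 i); rewrite -mulrA in h2; lra.
  case: br => _; apply; rewrite -pg; apply: open_nbhs_nbhs; split=> //.
  exact/Dp/leqW.
have [s [t [g [garc gP]]]] := arc_chain arcs.
have [st _ _ _ _] := garc.
have total : (path_length s t g <= (c * K)%:E)%E.
  have [|j jn [_ lj _]] := gP t; first by rewrite in_itv/= st lexx.
  apply: le_trans lj _; rewrite lee_fin -mulr_sumr ler_pM2l//; apply: le_trans tot.
  rewrite [leRHS](big_cat_nat _ (n := j.+1))//= lerDl.
  by apply: sumr_ge0.
exists s, t, g; split=> //; first exact: le_lt_trans total (ltry _).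
move=> r rI; have [j jn [pj lj rj]] := gP r rI.
apply: (@le_trans _ _ (M * (c * d j))%:E).
  rewrite mulrCA ge_min; have [h|h] := sums j jn; apply/orP; [left|right].
    by apply: le_trans lj _; rewrite -mulr_sumr lee_fin ler_pM2l.
  by apply: le_trans rj _; rewrite -mulr_sumr lee_fin ler_pM2l.
rewrite EFinM lee_wpmul2l// ?lee_fin//; apply: le_boundary_dist => q bq.
have := far j q jn bq; have := metric_triangle (p j) (g r) q.
by rewrite -mulrA; have := mulr_ge0 (ltW c0) (d0 j); lra.
Qed.

(** Take the first [k] where the trailing bound must be used: the terms before it fall under the
    leading bound at [k - 1], the others under the trailing bound at [k]. If there is no such [k],
    the leading bound at [n] covers everything. *)
Lemma sum_le_of_halves (R : realType) (d : nat -> R) (M A : R) n :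
  0 <= M -> 0 <= A -> (forall i, 0 <= d i) -> (forall i, (i <= n)%N -> d i <= A) ->
  (forall k, (k <= n)%N ->
     \sum_(0 <= i < k.+1) d i <= M * d k \/ \sum_(k <= i < n.+1) d i <= M * d k) ->
  \sum_(0 <= i < n.+1) d i <= 2 * M * A.
Proof.
move=> M0 A0 d0 dA sums.
have MA k : (k <= n)%N -> M * d k <= M * A by move=> kn; rewrite ler_wpM2l// dA.
have MA0 : 0 <= M * A by rewrite mulr_ge0.
suff : forall k, (k <= n)%N -> \sum_(0 <= i < k.+1) d i <= M * d k \/
    \sum_(0 <= i < n.+1) d i <= 2 * M * A.
  by move=> /(_ n (leqnn _)) [h|//]; have := MA n (leqnn _); lra.
elim=> [|k IH] kn.
  have [h|h] := sums 0%N isT; [by left|right]; have := MA 0%N isT; lra.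
have [h|h] := sums k.+1 kn; first by left.
right; have [h'|//] := IH (ltnW kn).
rewrite (big_cat_nat _ (n := k.+1))//=; last exact: leqW.
have := MA k (ltnW kn); have := MA k.+1 kn; lra.
Qed.

Theorem theorem1 (R : realType) (c c1 H b : R) :
  exists b' : R, forall (X Y : metricType R) (G : set X) (G' : set Y)
    (f : X -> Y) (D : set X),
    complete_metric X -> complete_metric Y ->
    quasiconvex c [set: X] -> quasiconvex c [set: Y] ->
    domain G -> G `<` [set: X] ->
    domain G' -> G' `<` [set: Y] -> quasiconvex c1 G' ->
    homeomorphism_on G G' f -> weakly_quasisymmetric H G f ->
    D `<=` G -> uniform_domain b D ->
    uniform_domain b' (f @` D).
Proof.
have [c_ge1|c_lt1] := leP 1 c; last first.
  (* For [c < 1] no set is [c]-quasiconvex, so any constant serves. *)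
  by exists 0 => X Y G G' f D _ _ [] /(lt_le_trans c_lt1); rewrite ltxx.
pose H1 := Num.max H 1; pose B := Num.max b 1.
have H1_ge1 : 1 <= H1 by rewrite le_max lexx orbT.
have B_ge1 : 1 <= B by rewrite le_max lexx orbT.
have bB : b <= B by rewrite le_max lexx.
have B0 : 0 < B by lra.
have c40 : 0 < 4 * c by lra.
have eps0 : 0 < (4 * c)^-1 by rewrite invr_gt0.
(* At ratio [tau0] image steps are at most [1 / (4 * c)] of the compared distance; passing to the
   boundary by [boundary_distortion] halves the ratio, hence [t1]. *)
have [tau0 tau00 small0] := distortion_small c1 H1_ge1 eps0.
pose t1 := tau0 / 2; have t10 : 0 < t1 by rewrite divr_gt0.
have [E1 E10 large1] := distortion_large B (2 * (B / t1)) H1_ge1.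
have [E2 E20 large2] := distortion_large B (B / t1) H1_ge1.
have eps1 : 0 < (2 * (1 + E2))^-1 by rewrite invr_gt0; lra.
have [tau tau_gt0 small1] := distortion_small c1 H1_ge1 eps1.
(* [E1], [E2] and [tau] feed [chain_sums]; [E3] and [E4] compare every image step with
   [mdist (f x) (f y)]. *)
have [E3 E30 large3] := distortion_large B (2 * B) H1_ge1.
have [E4 E40 large4] := distortion_large B B H1_ge1.
have [m mP] := exists_expr_ge (2 * (B / t1) / tau) (divr_gt0 t10 B0).
pose M := 2 * m.+1%:R * (1 + E1 * (1 + E2)); pose A := E3 * (1 + E4).
have M0 : 0 <= M.
  by rewrite !mulr_ge0// addr_ge0// mulr_ge0 ?addr_ge0// ltW.
have A0 : 0 <= A by rewrite mulr_ge0 ?addr_ge0// ltW.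
(* [M] serves the cigar condition, the other summand the length condition. All constants are fixed
   before the spaces, from [c], [c1], [H] and [b] alone. *)
exists (M + c * (2 * M * A)).
have cMA0 : 0 <= c * (2 * M * A).
  by apply: mulr_ge0; [lra|exact: mulr_ge0 (mulr_ge0 _ M0) A0].
move=> X Y G G' f D cX _ qX qY [_ oG _] GX dG' G'Y qG' fh fH DG uD.
have fH1 : weakly_quasisymmetric H1 G f.
  move=> z a w Gz Ga Gw zaw; apply: le_trans (fH _ _ _ Gz Ga Gw zaw) _.
  by rewrite ler_wpM2r ?mdist_ge0// le_max lexx.
have qD := uniform_quasiconvex uD.
have [dD DX _] := uD; have [D0 oD _] := dD.
have bD := boundary_nonempty qX oD D0 DX.
have dD' : domain (f @` D) := homeomorphism_on_domain fh dD DG dG'.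
have [_ oD' _] := dD'.
have fD'G' : f @` D `<=` G' by case: fh => _ fG _ _ [z Dz <-]; exact/fG/DG.
have large T : exists2 E, 0 < E & distortion E T D f.
  by have [E E0 fE] := distortion_large B T H1_ge1; exists E => //; exact: fE fH1 DG qD.
have restrict E T : distortion E T G f -> distortion E T D f.
  by move=> fE z a w Dz Da Dw; apply: fE; exact: DG.
split=> //.
  by split=> [//|YD]; apply: G'Y.2 => y Yy; exact/fD'G'/YD.
move=> _ _ [x Dx <-] [y Dy <-].
have [n [z [lam [mu [[z0 zn Dz zxy] [[full near_ stepB] [lamS muS lm0 cigar]]]]]]] :=
  uniform_chain bD uD bB t10 Dx Dy.
have far i q : (i <= n)%N -> boundary (f @` D) q ->
    4 * c * mdist (f (z i)) (f (z i.+1)) <= mdist (f (z i)) q.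
  move=> ni bq; rewrite -(ler_pdivlMl _ _ c40).
  have [Dzi Dzi1] := (Dz i (leqW ni), Dz i.+1 ni).
  have fD := restrict _ _ (small0 _ _ _ _ _ fh qG' fH1).
  exact: (boundary_distortion cX oG fh oD DG oD' eps0 tau00 fD large Dzi Dzi1
    (bdist_gt0 oD bD Dzi) (@bdist_le _ _ D (z i)) (near_ i ni) bq).
have mP' : 2 * (B / t1) <= tau * (1 + t1 / B) ^+ m.
  by rewrite [leRHS]mulrC -(ler_pdivrMr _ _ tau_gt0).
have sums := chain_sums B0 t10 E10 E20 tau_gt0 (large1 _ _ _ _ _ fH1 DG qD)
  (large2 _ _ _ _ _ fH1 DG qD) (restrict _ _ (small1 _ _ _ _ _ fh qG' fH1)) mP'
  Dz full lamS muS lm0 cigar.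
have dA i : (i <= n)%N ->
    mdist (f (z i)) (f (z i.+1)) <= A * mdist (f x) (f y).
  move=> ni; have [zi zi1] := (Dz i (leqW ni), Dz i.+1 ni).
  apply: (step_compare E30 (large3 _ _ _ _ _ fH1 DG qD) (large4 _ _ _ _ _ fH1 DG qD)) => //.
  - exact: ltW.
  - exact: stepB.
  - by have [] := zxy i (leqW ni).
have total := sum_le_of_halves M0 (mulr_ge0 A0 (mdist_ge0 (f x) (f y)))
  (fun i => mdist_ge0 (f (z i)) (f (z i.+1))) dA sums.
have D'z i : (i <= n.+1)%N -> (f @` D) (f (z i)) by move=> ni; exists (z i) => //; exact: Dz.
have [s [t [g [garc gfin gcig gl]]]] :=
  @uniform_arc_of_chain _ _ _ _ _ _ (fun i => f (z i)) n qY oD' M0 D'z far sums total.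
exists s, t, g; rewrite z0 zn in garc; split=> //.
- move=> r rI; apply: le_trans (gcig r rI) _.
  by rewrite lee_wpmul2r ?edist_inf_ge0// lee_fin lerDl.
- apply: le_trans gl _; rewrite lee_fin.
  apply: (@le_trans _ _ (c * (2 * M * A) * mdist (f x) (f y))).
    by rewrite !mulrA.
  by rewrite ler_wpM2r ?mdist_ge0// lerDr.
Qed.
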